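(* For positive integers $p$ and $n$, \[ \sum_{k=1}^nH_k^p= (n+1)H_n^p +(-1)^p p!\, n +\sum_{j=1}^{p-1}\frac{(-1)^jp!}{2(p-j)!}(2n+1)H_n^{p-j} -\sum_{j=1}^{p-1}\frac{(-1)^jp!}{2(p-j)!}\sum_{I\vDash p-j}\frac{i_1-1}{i_1+1}\binom{p-j}{I}\zeta_n(I). \]
   Context: $H_n=\sum_{i=1}^n 1/i$ is the $n$th harmonic number and $H_n^p=(H_n)^p$. For integers $a_1,\dots,a_k$, $\zeta_n(a_1,\dots,a_k)=\sum_{n\ge n_1>n_2>\dots>n_k\ge 1} n_1^{-a_1}\cdots n_k^{-a_k}$ (empty sum $=0$). $I\vDash m$ means that $I=(i_1,\dots,i_d)$ is a composition of $m$ (ordered tuple of positive integers with sum $m$), $i_1$ is its first part, $\binom{m}{I}=\frac{m!}{i_1!\cdots i_d!}$, and $\zeta_n(I)=\zeta_n(i_1,\dots,i_d)$. *)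

(* Defs.v *)
From mathcomp Require Import all_boot all_order all_algebra.
Set Implicit Arguments.
Unset Strict Implicit.
Unset Printing Implicit Defensive.
Import Order.TTheory GRing.Theory Num.Theory.
Local Open Scope ring_scope.

Definition harmonic (n : nat) : rat := \sum_(1 <= i < n.+1) (i%:R)^-1.

(* The tuple t lists the indices n >= n_1 > ... > n_k >= 1. *)
Definition mzeta (n : nat) (a : seq int) : rat :=
  \sum_(t : (size a).-tuple 'I_n.+1 |
        sorted gtn (map val t) && (0%N \notin map val t))
    \prod_(i < size a) ((tnth t i : nat)%:R : rat) ^ (- a`_i).

Definition is_composition (m : nat) (I : seq nat) : bool :=
  (0%N \notin I) && (sumn I == m).

(* Every composition of m has at most m parts, each at most m, so it occurs
   exactly once below, as a d-tuple over 'I_m.+1 with d <= m. *)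
Definition sum_compositions (m : nat) (F : seq nat -> rat) : rat :=
  \sum_(d < m.+1) \sum_(I : d.-tuple 'I_m.+1 | is_composition m (map val I))
    F (map val I).

Definition multinomial_coef (m : nat) (I : seq nat) : rat :=
  (m`!)%:R / \prod_(i <- I) (i`!)%:R.

Definition first_part (I : seq nat) : nat := head 0%N I.

(* Main.v *)
Require Import Defs.
From mathcomp Require Import all_boot all_order all_algebra.
From mathcomp Require Import ring.
Import Order.TTheory GRing.Theory Num.Theory.
Local Open Scope ring_scope.

(** The identity is proved by induction on [n]: it suffices to compare the
    increments of both sides when [n] becomes [n + 1].  Write x = H_n,
    h = H_(n+1), N = n + 1 and y = 1/N = h - x.

    The only terms whose increments are not visible are the weighted sums
    W(n, m) of binom(m, I) zeta_n(I) over the compositions I of m.  Splitting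
    off the first part i of I, which is the exponent of the largest summation
    index, gives two recursions: binom(m, I) = binom(m, i) binom(m - i, I'),
    and zeta_(n+1)(I) - zeta_n(I) = y^i zeta_n(I').  Hence the increment of
    W(., m) is the sum over i of w(i) binom(m, i) y^i W_1(n, m - i), where W_1
    has weight 1 ([weighted_zetaS]).  For w = 1 this is the recursion that the
    binomial theorem gives for (x + y)^m, so W_1(n, m) = H_n^m
    ([weighted_zeta_const1]).

    For w(i) = (i - 1)/(i + 1) = 1 - 2/(i + 1), the factor 1/(i + 1) turns
    binom(m, i) into binom(m + 1, i + 1)/(m + 1), so the increment of W(., m)
    is h^m + x^m - 2N (h^(m+1) - x^(m+1))/(m + 1)
    ([weighted_zeta_increment]).  With D_m = (h^m - x^m)/m!, the increment of
    the j-th term of the right-hand side is then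
    (-1)^j p! N (D_(p-j) + D_(p-j+1)), and the alternating sum telescopes to
    p! N (-(-1)^p D_1 - D_p) ([alternating_telescope]).  Since N D_1 = 1, what
    remains of the total increment is exactly h^p. *)

(** * Sums over tuples *)

Lemma big_tuple_cons (R : nmodType) (T : finType) (d : nat)
    (P : pred (d.+1.-tuple T)) (F : d.+1.-tuple T -> R) :
  \sum_(t | P t) F t =
  \sum_(x : T) \sum_(t | P (cons_tuple x t)) F (cons_tuple x t).
Proof.
rewrite pair_big_dep /=.
rewrite (reindex (fun q : T * d.-tuple T => cons_tuple q.1 q.2)) //=.
exists (fun t : d.+1.-tuple T => (thead t, behead_tuple t)).
  by case=> x t _; congr pair; apply: val_inj.
by move=> t _; rewrite [RHS]tuple_eta; apply: val_inj.
Qed.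

Lemma big_tuple0 (R : nmodType) (T : finType)
    (P : pred (0.-tuple T)) (F : 0.-tuple T -> R) :
  \sum_(t | P t) F t = if P [tuple] then F [tuple] else 0.
Proof.
rewrite big_mkcond /= (big_pred1 [tuple]) => [|t] //=.
by rewrite (tuple0 t) /= -(tuple0 t) eqxx.
Qed.

Lemma big_ord_pos_lt (R : nmodType) (x N : nat) (F : nat -> R) :
    (x <= N)%N ->
  \sum_(i < N | (0 < i < x)%N) F i = \sum_(1 <= i < x) F i.
Proof.
move=> le_xN; rewrite (big_nat_widen _ _ _ _ _ le_xN).
by rewrite (big_nat_widenl 1 0) // big_mkord; apply: eq_bigl => i; rewrite andbC.
Qed.

(** * Sums over compositions *)

(** Sum of F over the compositions of m with exactly d parts, computed by
    choosing the first part.  Unlike the defining sum over tuples, it does not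
    refer to an ambient bound for the parts, so it can be used with m replaced
    by m - i. *)
Fixpoint comp_sum (d m : nat) (F : seq nat -> rat) : rat :=
  if d is d'.+1 then
    \sum_(1 <= i < m.+1) comp_sum d' (m - i) (fun I => F (i :: I))
  else if m == 0%N then F [::] else 0.

(** Parts of a composition of m never exceed m, so the bound k is immaterial.
    This freedom is what makes the induction on the number of parts work: the
    remaining parts sum to m - i but still range over the original type. *)
Lemma comp_sum_tuple (d m k : nat) (F : seq nat -> rat) : (m <= k)%N ->
  \sum_(I : d.-tuple 'I_k.+1 | is_composition m (map val I)) F (map val I) =
  comp_sum d m F.
Proof.
elim: d m F => [|d IHd] m F le_mk.
  by rewrite big_tuple0 /= /is_composition /= eq_sym.
rewrite big_tuple_cons /=.
rewrite -(big_ord_pos_lt _ _ _ _ (le_mk : (m.+1 <= k.+1)%N)) [RHS]big_mkcond /=.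
apply: eq_bigr => i _; case: ifP => [/andP[i_gt0 i_le]|i_out].
  rewrite -IHd ?(leq_trans (leq_subr _ _)) //; apply: eq_bigl => I.
  rewrite /is_composition /= inE negb_or (ltn_eqF i_gt0) /=.
  by rewrite -[in RHS](eqn_add2l i) subnKC.
rewrite big_pred0 // => I; apply/negP=> /andP[].
rewrite inE negb_or /= => /andP[i_neq0 _] /eqP sumI.
by move: i_out; rewrite lt0n eq_sym i_neq0 ltnS -sumI leq_addr.
Qed.

Lemma comp_sum_gt (d m : nat) (F : seq nat -> rat) :
  (m < d)%N -> comp_sum d m F = 0.
Proof.
elim: d m F => [|d IHd] m F //= lt_md; rewrite big_nat_cond big1 // => i.
rewrite andbT => /andP[i_gt0 i_le]; apply: IHd.
by apply: leq_trans (lt_md : (m <= d)%N); rewrite ltn_subrL i_gt0 (leq_trans i_gt0).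
Qed.

(** Allowing more parts than m adds only empty sums; the free bound N lets
    compositions of m and of m - i be summed over the same range. *)
Lemma sum_compositionsE (m N : nat) (F : seq nat -> rat) : (m <= N)%N ->
  sum_compositions m F = \sum_(d < N.+1) comp_sum d m F.
Proof.
move=> le_mN; transitivity (\sum_(d < m.+1) comp_sum d m F).
  by apply: eq_bigr => d _; apply: comp_sum_tuple.
rewrite (big_ord_widen _ (fun d => comp_sum d m F) (le_mN : (m.+1 <= N.+1)%N)).
rewrite big_mkcond; apply: eq_bigr => d _.
by case: ltnP => // lt_md; rewrite comp_sum_gt.
Qed.

Lemma sum_compositions0 (F : seq nat -> rat) : sum_compositions 0 F = F [::].
Proof. by rewrite (sum_compositionsE 0 0) // big_ord1. Qed.

Lemma sum_compositions_cons (m : nat) (F : seq nat -> rat) : (0 < m)%N ->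
  sum_compositions m F =
  \sum_(1 <= i < m.+1) sum_compositions (m - i) (fun I => F (i :: I)).
Proof.
case: m => // m _.
rewrite (sum_compositionsE _ m.+1) // big_ord_recl /= add0r exchange_big /=.
apply: eq_big_nat => i /andP[i_gt0 _]; rewrite (sum_compositionsE _ m) //.
by rewrite leq_subLR -add1n leq_add2r.
Qed.

Lemma eq_sum_compositions (m : nat) (F G : seq nat -> rat) :
    (forall I, is_composition m I -> F I = G I) ->
  sum_compositions m F = sum_compositions m G.
Proof. by move=> eqFG; do 2!apply: eq_bigr => ? ?; apply: eqFG. Qed.

Lemma sum_compositionsZ (m : nat) (c : rat) (F : seq nat -> rat) :
  sum_compositions m (fun I => c * F I) = c * sum_compositions m F.
Proof.
rewrite /sum_compositions mulr_sumr.
by apply: eq_bigr => d _; rewrite mulr_sumr.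
Qed.

Lemma sum_compositionsD (m : nat) (F G : seq nat -> rat) :
  sum_compositions m (fun I => F I + G I) =
  sum_compositions m F + sum_compositions m G.
Proof.
by rewrite /sum_compositions -big_split; apply: eq_bigr => d _; rewrite big_split.
Qed.

(** * Truncated multiple zeta values *)

(** The multiple zeta sum restricted to indices strictly below x: a strict bound
    makes the condition on the next index the same as the one on the first. *)
Fixpoint mzeta_lt (s : seq int) (x : nat) : rat :=
  if s is a :: s' then \sum_(1 <= k < x) (k%:R : rat) ^ (- a) * mzeta_lt s' k
  else 1.

Lemma mzeta_lt_tuple (N x : nat) (s : seq int) : (x <= N)%N ->
  \sum_(t : (size s).-tuple 'I_N |
        path gtn x (map val t) && (0%N \notin map val t))
    \prod_(i < size s) ((tnth t i : nat)%:R : rat) ^ (- s`_i) =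
  mzeta_lt s x.
Proof.
elim: s x => [|a s IHs] x le_xN /=; first by rewrite big_tuple0 /= big_ord0.
rewrite big_tuple_cons -(big_ord_pos_lt _ _ _ _ le_xN) [RHS]big_mkcond /=.
apply: eq_bigr => k _; case: ifP => [/andP[k_gt0 lt_kx]|k_out].
  rewrite -IHs ?(ltnW (ltn_ord k)) // mulr_sumr.
  apply: eq_big => [t|t _].
    by rewrite lt_kx /= inE negb_or (ltn_eqF k_gt0).
  rewrite big_ord_recl /= tnth0; congr (_ * _).
  by apply: eq_bigr => i _; rewrite tnthS.
rewrite big_pred0 // => t; apply/negP=> /andP[/= /andP[lt_kx _]].
rewrite inE negb_or /= => /andP[k_neq0 _].
by move: k_out; rewrite lt0n eq_sym k_neq0 lt_kx.
Qed.

Lemma mzetaE (n : nat) (s : seq int) : mzeta n s = mzeta_lt s n.+1.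
Proof.
rewrite -(mzeta_lt_tuple n.+1) //; apply: eq_bigl => t; congr (_ && _).
by case: (tval t) => //= k u; rewrite ltn_ord.
Qed.

Lemma mzeta_nil (n : nat) : mzeta n [::] = 1.
Proof. by rewrite mzetaE. Qed.

Lemma mzeta0_cons (a : int) (s : seq int) : mzeta 0 (a :: s) = 0.
Proof. by rewrite mzetaE /= big_geq. Qed.

(** The new terms are those whose largest index is n + 1; their other indices
    are at most n. *)
Lemma mzetaS_cons (n : nat) (a : int) (s : seq int) :
  mzeta n.+1 (a :: s) = mzeta n (a :: s) + n.+1%:R ^ (- a) * mzeta n s.
Proof. by rewrite !mzetaE /= big_nat_recr. Qed.

(** * Weighted sums of multiple zeta values over compositions *)

Definition weighted_zeta (w : nat -> rat) (n m : nat) : rat :=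
  sum_compositions m (fun I : seq nat =>
    w (first_part I) * multinomial_coef m I * mzeta n (map Posz I)).

Lemma multinomial_coef_cons (m i : nat) (I : seq nat) : (i <= m)%N ->
  multinomial_coef m (i :: I) = 'C(m, i)%:R * multinomial_coef (m - i) I.
Proof.
move=> le_im; rewrite /multinomial_coef big_cons -(bin_fact le_im) !natrM.
have i_neq0 : (i`!)%:R != 0 :> rat by rewrite pnatr_eq0 -lt0n fact_gt0.
by rewrite invfM !mulrA; congr (_ / _); rewrite mulrAC mulfK // mulrAC.
Qed.

Lemma weighted_zeta0 (w : nat -> rat) (m : nat) :
  (0 < m)%N -> weighted_zeta w 0 m = 0.
Proof.
move=> m_gt0; rewrite /weighted_zeta sum_compositions_cons // big1 // => i _.
rewrite -[RHS](mul0r (sum_compositions (m - i) (fun=> 0))) -sum_compositionsZ.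
by apply: eq_sum_compositions => I _; rewrite /= mzeta0_cons !mulr0.
Qed.

(** Only the first part meets the new index n + 1, so the weight, which depends
    on the first part alone, disappears from the sum over the other parts. *)
Lemma weighted_zetaS (w : nat -> rat) (n m : nat) : (0 < m)%N ->
  weighted_zeta w n.+1 m = weighted_zeta w n m +
    \sum_(1 <= i < m.+1)
      w i * 'C(m, i)%:R * n.+1%:R^-1 ^+ i * weighted_zeta (fun=> 1) n (m - i).
Proof.
move=> m_gt0; rewrite /weighted_zeta !(sum_compositions_cons m) // -big_split /=.
apply: eq_big_nat => i /andP[_ le_im].
rewrite -sum_compositionsZ -sum_compositionsD.
apply: eq_sum_compositions => I _.
rewrite mzetaS_cons mulrDr; congr (_ + _).
rewrite multinomial_coef_cons // exprVn -exprnN /=; ring.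
Qed.

Lemma harmonicS (n : nat) : harmonic n.+1 = harmonic n + n.+1%:R^-1.
Proof. by rewrite /harmonic big_nat_recr. Qed.

Lemma harmonic0 : harmonic 0 = 0.
Proof. by rewrite /harmonic big_geq. Qed.

(** Expanding the m-th power of the sum 1/1 + ... + 1/n and grouping the terms
    by their distinct indices gives this sum; here the increments in n of both
    sides are compared through the binomial theorem. *)
Lemma weighted_zeta_const1 (n m : nat) :
  weighted_zeta (fun=> 1) n m = harmonic n ^+ m.
Proof.
elim: n m => [|n IHn] [|m]; rewrite ?expr0.
- by rewrite /weighted_zeta sum_compositions0 mzeta_nil /multinomial_coef big_nil fact0 divr1.
- by rewrite weighted_zeta0 // harmonic0 expr0n.
- by rewrite /weighted_zeta sum_compositions0 mzeta_nil /multinomial_coef big_nil fact0 divr1.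
rewrite weighted_zetaS // IHn harmonicS exprDn big_ord_recl /= subn0 bin0 mulr1 mulr1n.
congr (_ + _); rewrite big_add1 /= big_mkord; apply: eq_bigr => i _.
by rewrite IHn mul1r -mulr_natl; ring.
Qed.

(** * Increments and telescoping *)

(** By (i - 1)/(i + 1) = 1 - 2/(i + 1), the sum splits into a binomial expansion
    and an integrated one, the latter with y = 1/N dividing.  The range starts
    at i = 1 because compositions have positive parts; the term i = 0 would be
    - x^m, whence + x^m on the right. *)
Lemma binomial_ratio_sum (x y N : rat) (m : nat) : y * N = 1 ->
  \sum_(1 <= i < m.+1) (i%:R - 1) / (i%:R + 1) * 'C(m, i)%:R * y ^+ i * x ^+ (m - i)
  = (x + y) ^+ m + x ^+ m
    - 2 * N * ((x + y) ^+ m.+1 - x ^+ m.+1) / m.+1%:R.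
Proof.
move=> yN.
have m1_neq0 : m.+1%:R != 0 :> rat by rewrite pnatr_eq0.
have shift : \sum_(i < m.+1) 'C(m, i)%:R / i.+1%:R * y ^+ i * x ^+ (m - i)
    = N * ((x + y) ^+ m.+1 - x ^+ m.+1) / m.+1%:R.
  rewrite exprDn [in RHS]big_ord_recl /= subn0 bin0 mulr1 mulr1n [X in X - _]addrC addrK.
  rewrite mulrAC mulr_sumr; apply: eq_bigr => i _.
  rewrite /bump leq0n add1n subSS -[(_ * _) *+ _]mulr_natl exprS.
  have i1_neq0 : i.+1%:R != 0 :> rat by rewrite pnatr_eq0.
  have /(congr1 (fun k => k%:R : rat)) := mul_bin_diag m.+1 i.
  rewrite /= !natrM => diag.
  have -> : 'C(m.+1, i.+1)%:R = m.+1%:R * 'C(m, i)%:R / i.+1%:R :> rat.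
    by rewrite diag mulrC mulKf.
  (* One more factor y matches the exponent i + 1 on the right. *)
  rewrite -[LHS]mul1r -[X in X * _]yN.
  by field; rewrite !nat1r !pnatr_eq0.
have -> : (x + y) ^+ m = \sum_(i < m.+1) 'C(m, i)%:R * y ^+ i * x ^+ (m - i).
  by rewrite exprDn; apply: eq_bigr => i _; rewrite -mulr_natl; ring.
transitivity ((\sum_(0 <= i < m.+1)
    (i%:R - 1) / (i%:R + 1) * 'C(m, i)%:R * y ^+ i * x ^+ (m - i)) + x ^+ m).
  by rewrite [in RHS]big_ltn // bin0 subn0; field.
rewrite big_mkord addrAC -[2 * N * _]mulrA -[2 * (N * _) / _]mulrA -shift.
congr (_ + _); rewrite mulr_sumr -sumrB; apply: eq_bigr => i _.
have i1_neq0 : i.+1%:R != 0 :> rat by rewrite pnatr_eq0.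
by rewrite -natr1 in i1_neq0 *; field.
Qed.

(** Each D_k with 1 < k < p occurs in two consecutive terms, with opposite
    signs. *)
Lemma alternating_telescope (R : pzRingType) (D : nat -> R) (p : nat) : (0 < p)%N ->
  \sum_(1 <= j < p) (-1) ^+ j * (D (p - j)%N + D (p - j).+1) =
  - ((-1) ^+ p * D 1%N) - D p.
Proof.
move=> p_gt0; pose f j := - ((-1) ^+ j * D (p - j).+1).
transitivity (\sum_(1 <= j < p) (f j.+1 - f j)).
  apply: eq_big_nat => j /andP[_ lt_jp].
  by rewrite /f subnSK // exprS mulN1r mulNr !opprK mulrDr.
by rewrite telescope_sumr // /f subnn expr1 mulN1r opprK subnSK // subn0.
Qed.

Lemma weighted_zeta_increment (n m : nat) : (0 < m)%N ->
  let w i : rat := (i%:R - 1) / (i%:R + 1) in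
  let x := harmonic n in let h := harmonic n.+1 in
  weighted_zeta w n.+1 m - weighted_zeta w n m =
  h ^+ m + x ^+ m - 2 * n.+1%:R * (h ^+ m.+1 - x ^+ m.+1) / m.+1%:R.
Proof.
move=> m_gt0 w x h; rewrite weighted_zetaS // addrAC subrr add0r.
rewrite /h harmonicS -(binomial_ratio_sum _ _ _ m (mulVf _)) ?pnatr_eq0 //.
by apply: eq_bigr => i _; rewrite weighted_zeta_const1.
Qed.

Theorem corollary4p2 (p n : nat) (hp : (0 < p)%N) (hn : (0 < n)%N) :
  \sum_(1 <= k < n.+1) harmonic k ^+ p =
    (n%:R + 1) * harmonic n ^+ p + (-1) ^+ p * (p`!)%:R * n%:R
    + \sum_(1 <= j < p)
        (-1) ^+ j * (p`!)%:R / (2 * ((p - j)`!)%:R)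
        * (2 * n%:R + 1) * harmonic n ^+ (p - j)
    - \sum_(1 <= j < p)
        (-1) ^+ j * (p`!)%:R / (2 * ((p - j)`!)%:R)
        * sum_compositions (p - j) (fun I : seq nat =>
            ((first_part I)%:R - 1) / ((first_part I)%:R + 1)
            * multinomial_coef (p - j) I * mzeta n (map Posz I)).
Proof.
clear hn; pose w (i : nat) : rat := (i%:R - 1) / (i%:R + 1).
pose c j : rat := (-1) ^+ j * (p`!)%:R / (2 * ((p - j)`!)%:R).
pose A n := \sum_(1 <= j < p) c j * (2 * n%:R + 1) * harmonic n ^+ (p - j).
pose B n := \sum_(1 <= j < p) c j * weighted_zeta w n (p - j).
rewrite -[X in _ = _ - X]/(B n) -[X in _ = _ + X - _]/(A n).
elim: n => [|n IHn].
  rewrite big_geq // /A /B !big1_seq ?harmonic0 ?expr0n ?gtn_eqF //.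
    by rewrite !mulr0 !addr0.
    move=> j; rewrite mem_index_iota => /and3P[_ _ lt_jp].
    by rewrite weighted_zeta0 ?subn_gt0 // mulr0.
  move=> j; rewrite mem_index_iota => /and3P[_ _ lt_jp].
  by rewrite expr0n subn_eq0 leqNgt lt_jp mulr0.
rewrite big_nat_recr //= {}IHn.
set x := harmonic n; set h := harmonic n.+1.
pose D m : rat := (h ^+ m - x ^+ m) / (m`!)%:R.
have incr : (A n.+1 - B n.+1) - (A n - B n) =
    n.+1%:R * (p`!)%:R * (- ((-1) ^+ p * D 1%N) - D p).
  rewrite -alternating_telescope // mulr_sumr -!sumrB.
  apply: eq_big_nat => j /andP[_ lt_jp].
  have pj_gt0 : (0 < p - j)%N by rewrite subn_gt0.
  have := weighted_zeta_increment n _ pj_gt0; rewrite -/w -/x -/h /c /D factS natrM.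
  move/(canRL (subrK _)) ->.
  move: (p - j)%N => m in pj_gt0 *.
  have f_neq0 : (m`!)%:R != 0 :> rat by rewrite pnatr_eq0 -lt0n fact_gt0.
  by field; rewrite f_neq0 nat1r pnatr_eq0.
(* The weighted sums enter only through [incr]; the rest is rational algebra,
   in which D 1 = 1 / (n + 1) produces the constant (-1)^p p!. *)
have n1_neq0 : n.+1%:R != 0 :> rat by rewrite pnatr_eq0.
have f_neq0 : (p`!)%:R != 0 :> rat by rewrite pnatr_eq0 -lt0n fact_gt0.
rewrite -[RHS]addrA.
move/(canRL (subrK _)): incr => ->.
have -> : D 1%N = n.+1%:R^-1 by rewrite /D /h harmonicS !expr1 divr1 addrAC subrr add0r.
by rewrite /D; field; rewrite f_neq0 nat1r.
Qed.
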